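(* Let $R$ be an associative ring with unity and let $G$ be a torsion abelian group such that every prime $p\in\pi(G)$ is invertible in $R$. Then $\operatorname{Der}_R R[G]=0$, i.e. the only $R$-derivation of the group ring $R[G]$ is the zero map.
   Context: $\pi(G)$ is the set of primes dividing the orders of torsion elements of $G$. A derivation of a ring $B$ is an additive map $\delta:B\to B$ with $\delta(ab)=\delta(a)b+a\delta(b)$ for all $a,b\in B$. An $R$-derivation of $R[G]$ is a derivation $\delta$ of $R[G]$ with $\delta(R)=0$; $\operatorname{Der}_R R[G]$ is the set of all $R$-derivations of $R[G]$. *)

(* Defs.v *)
From HB Require Import structures.
From mathcomp Require Import all_boot ssralg.
From mathcomp Require Import finmap.
From mathcomp Require Import monalg.

Set Implicit Arguments.
Unset Strict Implicit.
Unset Printing Implicit Defensive.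

Import GRing.Theory.
Local Open Scope fset_scope.
Local Open Scope ring_scope.

(* The underlying additive group is that of finitely supported functions from
   G to R, which monalg provides for any choiceType.  The ring structure of
   monalg itself is unusable here: it requires a monomType, in which
   x * y = 1 forces x = y = 1, and this excludes every nontrivial group.
   A pzRingType may be noncommutative and may be the zero ring. *)
Definition group_ring (R : pzRingType) (G : groupType) : Type := {malg R[G]}.

HB.instance Definition _ R G := GRing.Zmodule.on (group_ring R G).

Section GroupRing.
Context (R : pzRingType) (G : groupType).
Implicit Types (a b c : {malg R[G]}) (g h : G) (r s : R).

Definition gr_one : {malg R[G]} := << 1 *g 1%g >>.

(* Convolution: (r g) (s h) = (r s) (g h), extended additively. *)
Definition gr_mul a b : {malg R[G]} :=
  \sum_(g <- msupp a) \sum_(h <- msupp b) << a@_g * b@_h *g (g * h)%g >>.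

Lemma gr_mulw (d1 d2 : {fset G}) a b :
  msupp a `<=` d1 -> msupp b `<=` d2 ->
  gr_mul a b = \sum_(g <- d1) \sum_(h <- d2) << a@_g * b@_h *g (g * h)%g >>.
Proof.
move=> le_d1 le_d2; rewrite /gr_mul (big_fset_incl _ le_d1) /=.
  apply/eq_bigr=> g _; apply/big_fset_incl => // h _ /mcoeff_outdom ->.
  by rewrite mulr0 monalgU0.
move=> g _ /mcoeff_outdom ag.
by rewrite big1 // => h _; rewrite ag mul0r monalgU0.
Qed.

Lemma gr_mulUU r s g h :
  gr_mul << r *g g >> << s *g h >> = << r * s *g (g * h)%g >>.
Proof. by rewrite (gr_mulw msuppU_le msuppU_le) !big_seq_fset1 !mcoeffUU. Qed.

Lemma gr_mulDl : left_distributive gr_mul +%R.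
Proof.
move=> a b c.
rewrite [in RHS](gr_mulw (fsubsetUl _ (msupp b)) (fsubset_refl _)).
rewrite [in RHS](gr_mulw (fsubsetUr (msupp a) _) (fsubset_refl _)).
rewrite (gr_mulw (msuppD_le _ _) (fsubset_refl _)).
rewrite -big_split /=; apply/eq_bigr=> g _.
rewrite -big_split /=; apply/eq_bigr=> h _.
by rewrite mcoeffD mulrDl monalgUD.
Qed.

Lemma gr_mulDr : right_distributive gr_mul +%R.
Proof.
move=> c a b.
rewrite [in RHS](gr_mulw (fsubset_refl _) (fsubsetUl _ (msupp b))).
rewrite [in RHS](gr_mulw (fsubset_refl _) (fsubsetUr (msupp a) _)).
rewrite (gr_mulw (fsubset_refl _) (msuppD_le _ _)).
rewrite -big_split /=; apply/eq_bigr=> g _.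
rewrite -big_split /=; apply/eq_bigr=> h _.
by rewrite mcoeffD mulrDr monalgUD.
Qed.

Lemma gr_mul0l : left_zero 0 gr_mul.
Proof. by move=> a; rewrite /gr_mul msupp0 big_seq_fset0. Qed.

Lemma gr_mul0r : right_zero 0 gr_mul.
Proof.
by move=> a; rewrite /gr_mul big1 // => g _; rewrite msupp0 big_seq_fset0.
Qed.

Lemma gr_mul_suml (I : Type) (t : seq I) (F : I -> {malg R[G]}) b :
  gr_mul (\sum_(i <- t) F i) b = \sum_(i <- t) gr_mul (F i) b.
Proof.
by rewrite (big_morph (gr_mul^~ b) (fun _ _ => gr_mulDl _ _ _) (gr_mul0l _)).
Qed.

Lemma gr_mul_sumr (I : Type) (t : seq I) (F : I -> {malg R[G]}) a :
  gr_mul a (\sum_(i <- t) F i) = \sum_(i <- t) gr_mul a (F i).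
Proof.
by rewrite (big_morph (gr_mul a) (fun _ _ => gr_mulDr _ _ _) (gr_mul0r _)).
Qed.

Lemma gr_mul1l : left_id gr_one gr_mul.
Proof.
move=> a; rewrite {1}[a]monalgE gr_mul_sumr [RHS]monalgE.
by apply/eq_bigr=> g _; rewrite gr_mulUU mul1r mul1g.
Qed.

Lemma gr_mul1r : right_id gr_one gr_mul.
Proof.
move=> a; rewrite {1}[a]monalgE gr_mul_suml [RHS]monalgE.
by apply/eq_bigr=> g _; rewrite gr_mulUU mulr1 mulg1.
Qed.

Lemma gr_mulA : associative gr_mul.
Proof.
move=> a b c; rewrite [a]monalgE !gr_mul_suml; apply/eq_bigr=> g _.
rewrite [b]monalgE gr_mul_suml !gr_mul_sumr gr_mul_suml.
apply/eq_bigr=> h _; rewrite [c]monalgE !gr_mul_sumr.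
by apply/eq_bigr=> k _; rewrite !gr_mulUU mulrA mulgA.
Qed.

End GroupRing.

HB.instance Definition _ (R : pzRingType) (G : groupType) :=
  GRing.Zmodule_isPzRing.Build (group_ring R G)
    (@gr_mulA R G) (@gr_mul1l R G) (@gr_mul1r R G)
    (@gr_mulDl R G) (@gr_mulDr R G).

(* The embedding of R into R[G], r |-> r 1_G. *)
Definition gr_const (R : pzRingType) (G : groupType) (r : R) : group_ring R G :=
  << r *g 1%g >>.

Definition is_derivation (B : pzRingType) (delta : B -> B) : Prop :=
  (forall a b : B, delta (a + b) = delta a + delta b) /\
  (forall a b : B, delta (a * b) = delta a * b + a * delta b).

Definition Der (R : pzRingType) (G : groupType)
    (delta : group_ring R G -> group_ring R G) : Prop :=
  is_derivation delta /\ (forall r : R, delta (gr_const G r) = 0).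

Definition abelian_group (G : groupType) : Prop :=
  forall g h : G, (g * h = h * g)%g.

Definition has_order (G : groupType) (g : G) (n : nat) : Prop :=
  [/\ (0 < n)%N, (g ^+ n = 1)%g &
      forall m : nat, (0 < m < n)%N -> (g ^+ m <> 1)%g].

Definition torsion_elt (G : groupType) (g : G) : Prop :=
  exists2 n : nat, (0 < n)%N & (g ^+ n = 1)%g.

Definition torsion_group (G : groupType) : Prop := forall g : G, torsion_elt g.

(* has_order g n already forces g to be a torsion element. *)
Definition group_primes (G : groupType) (p : nat) : Prop :=
  prime p /\ exists g : G, exists2 n : nat, has_order g n & p %| n.

(* A pzRingType has no predicate for units, so invertibility is spelled out. *)
Definition invertible (R : pzRingType) (x : R) : Prop :=
  exists y : R, x * y = 1 /\ y * x = 1.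

(* Main.v *)
Require Import Defs.
From mathcomp Require Import all_boot ssralg.
From mathcomp Require Import monalg.

(** If [g] has order [n], then [u = 1 g] is central in [R[G]] because [G] is
    abelian, so [0 = delta (u ^+ n) = n u ^+ (n - 1) (delta u)].  Both [u] and
    [n] are invertible, hence [delta u = 0], and [delta] vanishes on every
    [r g = (r 1) u]. *)

Set Implicit Arguments.
Unset Strict Implicit.
Unset Printing Implicit Defensive.

Import GRing.Theory.
Local Open Scope ring_scope.

Lemma invertibleM (R : pzRingType) (x y : R) :
  invertible x -> invertible y -> invertible (x * y).
Proof.
move=> [x' [xx' x'x]] [y' [yy' y'y]]; exists (y' * x'); split.
  by rewrite mulrA -(mulrA x) yy' mulr1.
by rewrite mulrA -(mulrA y') x'x mulr1.
Qed.

(** Strong induction on [n]: splitting off the prime [pdiv n] leaves a smaller positive quotient,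
    whose prime divisors still divide [n]. *)
Lemma invertible_natr (R : pzRingType) (n : nat) : (0 < n)%N ->
  (forall p, prime p -> p %| n -> invertible (p%:R : R)) ->
  invertible (n%:R : R).
Proof.
have [m] := ubnP n; elim: m n => // m IHm n; rewrite ltnS => le_nm n_gt0 invn.
have [n_le1|n_gt1] := leqP n 1.
  have /eqP -> : n == 1 by rewrite eqn_leq n_le1.
  by exists 1; rewrite mulr1.
have [p_pr pn] := (pdiv_prime n_gt1, pdiv_dvd n).
rewrite -(divnK pn) natrM; apply: invertibleM; last exact: invn.
apply: IHm => [||p' p'_pr p'n].
- by apply: leq_trans le_nm; rewrite ltn_Pdiv ?prime_gt1.
- by rewrite (divn_gt0 _ (pdiv_gt0 n)) pdiv_leq.
- by apply: invn => //; apply: dvdn_trans p'n (dvdn_div pn).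
Qed.

(** Bridges torsion, which gives only some exponent killing [g], and [group_primes], which is
    phrased with exact orders: take the least such exponent. *)
Lemma torsion_has_order (G : groupType) (g : G) :
  torsion_elt g -> exists n, has_order g n.
Proof.
move=> [n0 n0_gt0 gn0].
have ex_n : exists n, (0 < n)%N && (g ^+ n == 1)%g.
  by exists n0; rewrite n0_gt0 gn0 eqxx.
case: (ex_minnP ex_n) => n /andP[n_gt0 /eqP gn] minn; exists n; split=> // m.
move=> /andP[m_gt0 lt_mn] gm; move: (minn m); rewrite m_gt0 gm eqxx => /(_ isT).
by rewrite leqNgt lt_mn.
Qed.

Lemma derivation0 (B : pzRingType) (delta : B -> B) :
  is_derivation delta -> delta 0 = 0.
Proof. by move=> [dD _]; apply: (addrI (delta 0)); rewrite -dD !addr0. Qed.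

Lemma derivation1 (B : pzRingType) (delta : B -> B) :
  is_derivation delta -> delta 1 = 0.
Proof.
(* The Leibniz rule on [1 * 1] gives [delta 1 = delta 1 + delta 1]. *)
move=> [_ dM]; apply: (addrI (delta 1)).
by rewrite addr0 -[RHS](congr1 delta (mulr1 1)) dM mulr1 mul1r.
Qed.

Lemma derivation_sum (B : pzRingType) (delta : B -> B) (I : Type)
    (s : seq I) (F : I -> B) : is_derivation delta ->
  delta (\sum_(i <- s) F i) = \sum_(i <- s) delta (F i).
Proof. by move=> dd; apply: (big_morph delta dd.1 (derivation0 dd)). Qed.

(** Since [u] commutes with [delta u], every Leibniz term can be brought to the same form. The
    exponent [n.+1] avoids a predecessor. *)
Lemma derivationX (B : pzRingType) (delta : B -> B) (u : B) (n : nat) :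
    is_derivation delta -> GRing.comm u (delta u) ->
  delta (u ^+ n.+1) = (u ^+ n * delta u) *+ n.+1.
Proof.
move=> [_ dM] cu; elim: n => [|n IHn]; first by rewrite expr1 mul1r.
rewrite exprS dM IHn mulrnAr mulrA -exprS [RHS]mulrS; congr (_ + _).
exact: (commrX _ (commr_sym cu)).
Qed.

Lemma derivation_unity_root (B : pzRingType) (delta : B -> B) (u : B) n :
    is_derivation delta -> GRing.comm u (delta u) -> (0 < n)%N -> u ^+ n = 1 ->
  delta u *+ n = 0.
Proof.
case: n => // n dd cu _ un.
have := derivationX n dd cu; rewrite un (derivation1 dd).
(* Multiplying by [u] completes [u ^+ n] to [u ^+ n.+1 = 1], so no explicit inverse of [u]
   appears. *)
by move/(congr1 ( *%R u)); rewrite mulr0 mulrnAr mulrA -exprS un mul1r.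
Qed.

Section GroupRing.
Context (R : pzRingType) (G : groupType).
Implicit Types (g : G) (x : group_ring R G).

Definition gr_elt g : group_ring R G := << 1 *g g >>.

Lemma gr_eltX g n : gr_elt g ^+ n = gr_elt (g ^+ n)%g.
Proof.
elim: n => [|n IHn]; first by rewrite expr0 expg0.
by rewrite exprS IHn expgS [LHS](gr_mulUU 1 1) mulr1.
Qed.

Lemma gr_const_elt (r : R) g :
  gr_const G r * gr_elt g = << r *g g >> :> group_ring R G.
Proof. by rewrite [LHS](gr_mulUU r 1) mulr1 mul1g. Qed.

(** On monomials the coefficient 1 commutes with all of [R], even when [R] is noncommutative, so
    only commutation in [G] matters. *)
Lemma gr_elt_central g x : abelian_group G -> GRing.comm (gr_elt g) x.
Proof.
move=> abG; rewrite /GRing.comm /GRing.mul /= [x]monalgE.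
rewrite gr_mul_sumr gr_mul_suml.
by apply: eq_bigr => h _; rewrite !gr_mulUU mulr1 mul1r abG.
Qed.

(** The inverse of [n] lives in [R], so it is cancelled in each coefficient separately. *)
Lemma gr_mulrn_eq0 x n : invertible (n%:R : R) -> x *+ n = 0 -> x = 0.
Proof.
move=> [y [_ yn]] xn; apply/malgP => g; rewrite mcoeff0.
have /(congr1 (fun z : {malg R[G]} => y * z@_g)) := xn.
by rewrite mcoeffMn mcoeff0 mulr0 -mulr_natl mulrA yn mul1r.
Qed.

End GroupRing.

Theorem theorem2 (R : pzRingType) (G : groupType)
    (abG : abelian_group G) (torG : torsion_group G)
    (invR : forall p : nat, group_primes G p -> invertible (p%:R : R)) :
  forall delta : group_ring R G -> group_ring R G,
    Der delta <-> (forall x : group_ring R G, delta x = 0).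
Proof.
move=> delta; split=> [[dd dR] x|d0]; last first.
  by do 2?split=> *; rewrite !d0 ?mul0r ?mulr0 ?addr0.
have d_elt g : delta (gr_elt R g) = 0.
  have [n ord_g] := torsion_has_order (torG g); have [n_gt0 gn _] := ord_g.
  apply: (@gr_mulrn_eq0 _ _ _ n).
    (* A prime dividing the order of [g] lies in the set of primes of [G], with [g] itself as
       witness. *)
    apply: invertible_natr => // p p_pr pn; apply: invR.
    by split=> //; exists g, n.
  apply: derivation_unity_root => //; first exact: gr_elt_central.
  (* The remaining [gr_elt R 1] is the unit of the group ring by conversion. *)
  by rewrite gr_eltX gn.
rewrite [x]monalgE (derivation_sum _ _ dd) big1 // => g _.
(* Leibniz on constant times group element: [dR] kills one term, [d_elt] the other. *)
by rewrite -gr_const_elt dd.2 dR d_elt mul0r mulr0 addr0.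
Qed.
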